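(* Let $t\ge 1$ be an integer. Then $\chi_p(P_{3t}\Diamond_3 C_6)\le 4$ if $1\le t\le 2$, and $\chi_p(P_{3t}\Diamond_3 C_6)\le 5$ if $t\ge 3$. Moreover, equality holds for $t\in\{1,2\}$.
   Context: A packing $k$-coloring of a graph $H$ is a map $c:V(H)\to\{1,\ldots,k\}$ such that any two distinct vertices $u,v$ with $c(u)=c(v)=i$ satisfy $d_H(u,v)\ge i+1$. The packing chromatic number $\chi_p(H)$ is the least such $k$. $P_m$ denotes the path $v_1\cdots v_m$ and $C_n$ the cycle on $n$ vertices. Path-aligned product: for positive integers $\ell\mid m$ and a connected vertex-transitive graph $G$ containing $P_\ell$ as a subgraph, $P_m\Diamond_\ell G$ is formed from the path $P_m=v_1\cdots v_m$ and $m/\ell$ pairwise disjoint copies of $G$, where for each $1\le i\le m/\ell$ the consecutive path vertices $v_{(i-1)\ell+1},\ldots,v_{i\ell}$ are identified, in order, with the vertices of a path $P_\ell$ (i.e. $\ell$ consecutive cycle vertices when $G$ is a cycle) in the $i$-th copy of $G$. *)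

(* Defs.v *)
From mathcomp Require Import all_boot.

Set Implicit Arguments.
Unset Strict Implicit.
Unset Printing Implicit Defensive.

(* A finite simple graph is a symmetric irreflexive relation e on a finType;
   symmetry and irreflexivity of the graphs built below are proved as lemmas. *)

Section Distance.
Variables (T : finType) (e : rel T).
Implicit Types (u v : T) (n : nat).

Definition has_walk u v n : bool :=
  [exists p : n.-tuple T, path e u p && (last u p == v)].

Lemma has_walkP u v n :
  reflect (exists p : seq T, [/\ size p = n, path e u p & last u p = v])
          (has_walk u v n).
Proof.
apply: (iffP existsP) => [[p /andP[ep /eqP lp]]|[p [sp ep lp]]].
  by exists p; rewrite size_tuple.
by exists (tcast sp (in_tuple p)); rewrite val_tcast /= ep lp eqxx.
Qed.

Lemma connect_has_walk u v : connect e u v -> exists n, has_walk u v n.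
Proof.
by case/connectP=> p ep ->; exists (size p); apply/has_walkP; exists p.
Qed.

(* None stands for infinite distance (u and v in different components). *)
Definition gdist u v : option nat :=
  match @idP (connect e u v) with
  | ReflectT uv => Some (ex_minn (connect_has_walk uv))
  | ReflectF _ => None
  end.

Lemma gdist_SomeP u v d :
  gdist u v = Some d <->
  has_walk u v d /\ (forall n, has_walk u v n -> d <= n).
Proof.
rewrite /gdist; case: {-}_ / idP => [uv|nuv]; last first.
  split=> // -[/has_walkP[p [_ ep lp]] _]; case: nuv.
  by apply/connectP; exists p.
case: ex_minnP => m wm minm; split=> [[<-]|[wd mind]]; first by split.
by congr Some; apply/eqP; rewrite eqn_leq minm // mind.
Qed.

Definition dist_geq u v n : bool :=
  if gdist u v is Some d then n <= d else true.

End Distance.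

Section PackingColoring.
Variables (T : finType) (e : rel T).

(* The colors 1, ..., k are the nonzero elements of 'I_k.+1. *)
Definition packing_coloring (k : nat) (c : {ffun T -> 'I_k.+1}) : bool :=
  [forall v, 0 < c v] &&
  [forall u, forall v,
     (u != v) && (c u == c v) ==> dist_geq e u v (c u).+1].

Definition packing_colorable (k : nat) : bool :=
  [exists c : {ffun T -> 'I_k.+1}, packing_coloring c].

Lemma packing_colorable_ex : exists k, packing_colorable k.
Proof.
exists #|T|; apply/existsP; exists [ffun v => lift ord0 (enum_rank v)].
apply/andP; split; first by apply/forallP=> v; rewrite ffunE.
apply/forallP=> u; apply/forallP=> v; rewrite !ffunE.
by rewrite (inj_eq lift_inj) (inj_eq enum_rank_inj) andNb.
Qed.

Definition packing_chromatic_number : nat := ex_minn packing_colorable_ex.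

End PackingColoring.

(* The path v_1 ... v_m, with v_i represented by the ordinal i - 1. *)
Definition path_graph (m : nat) : rel 'I_m :=
  fun a b => (a.+1 == b :> nat) || (b.+1 == a :> nat).

(* The n-cycle; a simple graph for n >= 3. *)
Definition cycle_graph (n : nat) : rel 'I_n :=
  fun a b => (ordS a == b) || (ordS b == a).

Lemma cycle_graph_sym n : symmetric (@cycle_graph n).
Proof. by move=> a b; rewrite /cycle_graph orbC. Qed.

Lemma cycle_graph_irrefl n : 1 < n -> irreflexive (@cycle_graph n).
Proof.
move=> n_gt1 a; rewrite /cycle_graph orbb; apply/eqP=> /(congr1 val) /=.
have := ltn_ord a; rewrite leq_eqVlt => /orP[/eqP an|an].
  by rewrite an modnn => a0; rewrite -an -a0 in n_gt1.
by rewrite modn_small // => /eqP; rewrite eqn_leq ltnn.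
Qed.

Section PathAlignedProduct.
Variables (m l : nat) (V : finType) (g : rel V) (p : 'I_l -> V).

(* p lists in order the vertices of a path on l vertices in the graph g. *)
Definition path_in : Prop :=
  injective p /\ (forall i j : 'I_l, j = i.+1 :> nat -> g (p i) (p j)).

(* The vertex (i, x) is the vertex x of the i-th copy of g.  Since l divides m,
   every vertex of the path is identified with a vertex of some copy, so these
   are all the vertices of the product. *)
Definition aligned_vertex : finType := ('I_(m %/ l) * V)%type.

Definition identified (a : 'I_m) (u : aligned_vertex) : bool :=
  [exists j : 'I_l, (a == u.1 * l + j :> nat) && (u.2 == p j)].

Definition path_aligned_product : rel aligned_vertex :=
  fun u v =>
    ((u.1 == v.1) && g u.2 v.2) ||
    [exists a : 'I_m, exists b : 'I_m,
       [&& path_graph a b, identified a u & identified b v]].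

Lemma path_aligned_product_sym :
  symmetric g -> symmetric path_aligned_product.
Proof.
move=> g_sym u v; rewrite /path_aligned_product eq_sym g_sym; congr (_ || _).
by apply/existsP/existsP=> -[a /existsP[b /and3P[ab au bv]]];
  exists b; apply/existsP; exists a; rewrite /path_graph orbC au bv !andbT.
Qed.

Lemma path_aligned_product_irrefl :
  irreflexive g -> path_in -> irreflexive path_aligned_product.
Proof.
move=> g_irr [p_inj _] u; rewrite /path_aligned_product g_irr andbF /=.
apply/existsP=> -[a /existsP[b /and3P[ab]]].
case/existsP=> i /andP[/eqP ai /eqP ui] /existsP[j /andP[/eqP bj /eqP uj]].
have ij : i = j by apply: p_inj; rewrite -ui.
by move: ab; rewrite /path_graph ai bj ij orbb eqn_leq ltnn.
Qed.

End PathAlignedProduct.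

(* l consecutive vertices of the n-cycle, in order; as the automorphism group of
   the cycle acts transitively on such lists, the choice does not matter. *)
Definition cycle_arc (l n : nat) (ln : l <= n) : 'I_l -> 'I_n := widen_ord ln.

Lemma cycle_arc_path_in l n (ln : l <= n) :
  path_in (@cycle_graph n) (cycle_arc ln).
Proof.
split=> [i j /(congr1 val) ij|i j ij]; first exact: val_inj.
apply/orP; left; apply/eqP/val_inj; rewrite /= modn_small -ij //.
exact: leq_trans ln.
Qed.

Definition path_cycle_product (m l n : nat) (ln : l <= n) :
    rel (aligned_vertex m l 'I_n) :=
  path_aligned_product (@cycle_graph n) (cycle_arc ln).

(* Main.v *)
(** In [P_{3t} <>_3 C_6] consecutive copies of the hexagon are joined by the
    single edge from vertex 2 of one copy to vertex 0 of the next, so distances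
    are bounded below by an explicit formula.  Vertices three or more copies
    apart are at distance at least 7, hence whether a colouring that is periodic
    along the path is a packing colouring is a finite computation.  Conversely
    each copy is a hexagon, distances in the product are at most those in the
    hexagon, and the hexagon has no packing 3-colouring. *)
Require Import Defs.
From mathcomp Require Import all_boot zify.

Set Implicit Arguments.
Unset Strict Implicit.
Unset Printing Implicit Defensive.

Section Distances.
Variables (T : finType) (e : rel T).

Lemma path_potential (f : T -> nat) (u : T) (p : seq T) :
  (forall x y, e x y -> f y <= (f x).+1) ->
  path e u p -> f (last u p) <= f u + size p.
Proof.
move=> f_lip; elim: p u => [|x p IHp] u /=; first by rewrite addn0.
case/andP=> /f_lip fux /IHp; lia.
Qed.

Lemma dist_geq_potential (f : T -> nat) (u v : T) (n : nat) :
  (forall x y, e x y -> f y <= (f x).+1) ->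
  f u + n <= f v -> dist_geq e u v n.
Proof.
move=> f_lip fuv; rewrite /dist_geq; case duv: gdist => [d|//].
have [/has_walkP[p [sp ep lp]] _] := (gdist_SomeP e u v d).1 duv.
by have := path_potential f_lip ep; rewrite lp sp; lia.
Qed.

Lemma dist_geq_walk (u v : T) (n : nat) (p : seq T) :
  dist_geq e u v n -> path e u p -> last u p = v -> n <= size p.
Proof.
move=> duv ep lp; move: duv; rewrite /dist_geq /gdist.
case: {-}_ / idP => [uv|[]]; last by apply/connectP; exists p.
case: ex_minnP => d _ mind nd; apply: leq_trans nd (mind _ _).
by apply/has_walkP; exists p.
Qed.

Lemma packing_chromatic_number_leq (k : nat) (c : T -> nat) :
  (forall v, 0 < c v <= k) ->
  (forall u v, u != v -> c u = c v -> dist_geq e u v (c u).+1) ->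
  packing_chromatic_number e <= k.
Proof.
move=> c_range c_dist; rewrite /packing_chromatic_number.
case: ex_minnP => m _; apply.
have cE v : (inord (c v) : 'I_k.+1) = c v :> nat.
  by case/andP: (c_range v) => _ cv; rewrite inordK.
apply/existsP; exists [ffun v => inord (c v) : 'I_k.+1]; apply/andP; split.
  by apply/forallP=> v; rewrite ffunE cE; case/andP: (c_range v).
apply/forallP=> u; apply/forallP=> v; apply/implyP; rewrite !ffunE.
by case/andP=> uv /eqP/(congr1 val) /=; rewrite !cE; apply: c_dist.
Qed.

Lemma packing_chromatic_number_gt (k : nat) :
  (forall c : T -> nat, (forall v, 0 < c v <= k) ->
     ~ (forall u v, u != v -> c u = c v -> dist_geq e u v (c u).+1)) ->
  k < packing_chromatic_number e.
Proof.
move=> no_c; rewrite /packing_chromatic_number.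
case: ex_minnP => m /existsP[c /andP[/forallP c0 /forallP cd]] _.
rewrite ltnNge; apply/negP=> mk; case: (no_c (fun v => c v)) => [v|u v uv cuv].
  by rewrite c0; apply: leq_trans (leq_ord _) mk.
have /forallP/(_ v)/implyP := cd u; apply.
by rewrite uv; apply/eqP/val_inj.
Qed.

End Distances.

Lemma val_iter_ordS (k n : nat) (x : 'I_k) :
  iter n (@ordS k) x = (x + n) %% k :> nat.
Proof.
elim: n => [|n IHn]; first by rewrite addn0 modn_small.
by rewrite /= IHn -[in LHS]addn1 modnDml addn1 addnS.
Qed.

Definition hexagon_dist (x y : nat) : nat :=
  minn (maxn x y - minn x y) (6 - (maxn x y - minn x y)).

Lemma hexagon_dist_cycle (x y z : 'I_6) :
  cycle_graph y z -> hexagon_dist x z <= (hexagon_dist x y).+1.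
Proof.
rewrite /cycle_graph /hexagon_dist.
move: (ltn_ord x) (ltn_ord y) (ltn_ord z) => x6 y6 z6.
by case/orP=> /eqP/(congr1 val) /=; lia.
Qed.

Definition product_dist (i x j y : nat) : nat :=
  if i == j then hexagon_dist x y
  else if i < j then hexagon_dist x 2 + hexagon_dist 0 y + 3 * (j - i) - 2
  else hexagon_dist x 0 + hexagon_dist 2 y + 3 * (i - j) - 2.

Lemma hexagon_distC (x y : nat) : hexagon_dist x y = hexagon_dist y x.
Proof. by rewrite /hexagon_dist (maxnC x) (minnC x). Qed.

Lemma product_distC (i x j y : nat) :
  product_dist i x j y = product_dist j y i x.
Proof.
have h := hexagon_distC; rewrite /product_dist (h x y) (h x 0) (h x 2).
by rewrite (h y 0) (h y 2); case: ltngtP => _ //; lia.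
Qed.

Lemma hexagon_no_packing_3_coloring (a : 'I_6 -> nat) :
  (forall x, 0 < a x <= 3) ->
  exists x n, [/\ 0 < n <= 3, a x = a (iter n (@ordS 6) x) & n <= a x].
Proof.
move=> a_range; pose s := [seq a (inord x) | x <- iota 0 6].
pose clash s := has (fun x => has (fun n =>
  (nth 0 s x == nth 0 s ((x + n) %% 6)) && (n <= nth 0 s x)) (iota 1 3))
  (iota 0 6).
have clash_s : clash s.
  rewrite {}/s /=; move: (a_range (inord 0)) (a_range (inord 1))
    (a_range (inord 2)) (a_range (inord 3)) (a_range (inord 4))
    (a_range (inord 5)).
  by case: (a _) => [|[|[|[|//]]]] // _; case: (a _) => [|[|[|[|//]]]] // _;
     case: (a _) => [|[|[|[|//]]]] // _; case: (a _) => [|[|[|[|//]]]] // _;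
     case: (a _) => [|[|[|[|//]]]] // _; case: (a _) => [|[|[|[|//]]]] // _.
have sE (x : 'I_6) : nth 0 s x = a x.
  by rewrite (nth_map 0) ?size_iota // nth_iota // inord_val.
case/hasP: clash_s => x; rewrite mem_iota add0n => x6 /hasP[n].
rewrite mem_iota => n3; pose x' := Ordinal x6.
have -> : x = x' by [].
by rewrite -val_iter_ordS !sE => /andP[/eqP ? ?]; exists x', n; split.
Qed.

Definition valid_row (k : nat) (r : seq nat) : bool :=
  all (fun x => 0 < nth 0 r x <= k) (iota 0 6).

(* [r] and [r'] colour two copies whose positions along the path differ by
   [d]; for [d = 0] they are the same row. *)
Definition compatible_rows (d : nat) (r r' : seq nat) : bool :=
  all (fun x => all (fun y =>
    [|| (d == 0) && (x == y), nth 0 r x != nth 0 r' y |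
        nth 0 r x < product_dist 0 x d y]) (iota 0 6)) (iota 0 6).

Lemma compatible_rows_far (k d : nat) (r r' : seq nat) :
  valid_row k r -> k + 2 < 3 * d -> compatible_rows d r r'.
Proof.
move=> /allP r_ok kd; apply/allP=> x x6; apply/allP=> y _.
apply/orP; right; apply/orP; right; have /andP[_ rx] := r_ok x x6.
have d0 : 0 < d by lia.
by rewrite /product_dist eq_sym eqn0Ngt d0 /= subn0; lia.
Qed.

Lemma product_distDl (i x d y : nat) :
  product_dist i x (i + d) y = product_dist 0 x d y.
Proof.
rewrite /product_dist -{1 3}[i]addn0 eqn_add2l ltn_add2l addKn subn0.
case: eqP => // d0; case: ltnP => //; lia.
Qed.

Section HexagonProduct.
Variable m : nat.
Let V := aligned_vertex m 3 'I_6.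
Let E := @path_cycle_product m 3 6 isT.

Variant hexagon_edge_spec (u v : V) : Prop :=
| HexagonEdge of u.1 = v.1 & cycle_graph u.2 v.2
| LinkEdge of v.1 = u.1.+1 :> nat & u.2 = 2 :> nat & v.2 = 0 :> nat
| RevLinkEdge of u.1 = v.1.+1 :> nat & v.2 = 2 :> nat & u.2 = 0 :> nat.

Lemma hexagon_edgeP (u v : V) : E u v -> hexagon_edge_spec u v.
Proof.
case: u v => [i x] [j y] /orP[/andP[/eqP ? ?]|]; first exact: HexagonEdge.
case/existsP=> a /existsP[b /and3P[ab]].
case/existsP=> k /andP[/eqP /= ak /eqP xk] /existsP[l /andP[/eqP /= bl /eqP yl]].
have {xk} xk : x = k :> nat by rewrite xk.
have {yl} yl : y = l :> nat by rewrite yl.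
move: (ltn_ord k) (ltn_ord l) ab; rewrite /path_graph ak bl -xk -yl => x3 y3.
have [ij|ij] := eqVneq i j.
  rewrite ij => ab; apply: HexagonEdge => //; rewrite /cycle_graph.
  by case/orP: ab => ab; apply/orP; [left | right]; apply/eqP/val_inj => /=; lia.
have {}ij : (i : nat) != j by [].
by case/orP=> ab; [apply: LinkEdge | apply: RevLinkEdge] => /=; lia.
Qed.

Lemma product_dist_edge (i : nat) (x : 'I_6) (u v : V) :
  E u v -> product_dist i x v.1 v.2 <= (product_dist i x u.1 u.2).+1.
Proof.
case: u v => [j y] [l z] /hexagon_edgeP[] /= => [-> uv|uv u2 v2|uv u2 v2];
  rewrite /product_dist.
- move: (hexagon_dist_cycle x uv) (hexagon_dist_cycle (@Ordinal 6 0 isT) uv)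
    (hexagon_dist_cycle (@Ordinal 6 2 isT) uv) => /= h h0 h2.
  by case: eqP => // /eqP il; case: ltnP => _; lia.
- rewrite uv u2 v2 /hexagon_dist.
  by move: (ltn_ord x) => x6; case: (ltngtP i j) => ?; case: (ltngtP i j.+1) => ?; lia.
- rewrite uv u2 v2 /hexagon_dist.
  by move: (ltn_ord x) => x6; case: (ltngtP i l) => ?; case: (ltngtP i l.+1) => ?; lia.
Qed.

Lemma dist_geq_product_dist (u v : V) (n : nat) :
  n <= product_dist u.1 u.2 v.1 v.2 -> dist_geq E u v n.
Proof.
move=> nuv; apply: (@dist_geq_potential _ _
  (fun w : V => product_dist u.1 u.2 w.1 w.2)) => [x y|].
  exact: product_dist_edge.
by rewrite {1}/product_dist eqxx {1}/hexagon_dist maxnn minnn subnn min0n.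
Qed.

Lemma packing_chromatic_number_rows (k : nat) (r : nat -> seq nat) :
  (forall i, i < m %/ 3 -> valid_row k (r i)) ->
  (forall i d, i + d < m %/ 3 -> compatible_rows d (r i) (r (i + d))) ->
  packing_chromatic_number E <= k.
Proof.
move=> r_ok r_comp; pose c (v : V) := nth 0 (r v.1) v.2.
have i6 (x : 'I_6) : (x : nat) \in iota 0 6 by rewrite mem_iota ltn_ord.
apply: (@packing_chromatic_number_leq _ _ _ c) => [v|u v uv cuv].
  exact: (allP (r_ok _ (ltn_ord v.1))).
apply: dist_geq_product_dist.
wlog le_uv : u v uv cuv / u.1 <= v.1 => [hw|].
  case: (leqP u.1 v.1) => [|/ltnW] le_uv; first exact: hw.
  by rewrite product_distC cuv; apply: hw; rewrite 1?eq_sym.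
have vE : v.1 = u.1 + (v.1 - u.1) :> nat by rewrite subnKC.
have := r_comp u.1 (v.1 - u.1); rewrite -vE => /(_ (ltn_ord _)).
move=> /allP/(_ _ (i6 u.2))/allP/(_ _ (i6 v.2)).
rewrite -/(c u) -/(c v) cuv eqxx -(product_distDl u.1) -vE => /orP[|//].
case/andP=> vu /eqP uv2; case/eqP: uv; case: u v le_uv vu uv2 {cuv vE}.
move=> i x [j y] /= ij ji /val_inj ->; congr (_, _); apply/val_inj => /=.
by move: ji; rewrite subn_eq0 => ji; apply/eqP; rewrite eqn_leq ij.
Qed.

Lemma packing_chromatic_number_hexagon_product_le4 :
  m %/ 3 <= 2 -> packing_chromatic_number E <= 4.
Proof.
move=> m2; pose r i :=
  if odd i then [:: 3; 1; 2; 4; 1; 2] else [:: 1; 2; 1; 4; 1; 3].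
apply: (@packing_chromatic_number_rows _ r) => [i _|i d idm].
  by rewrite /r; case: odd.
by have := leq_trans idm m2; move: i d {idm} => [|[|i]] [|[|d]].
Qed.

Lemma packing_chromatic_number_hexagon_product_le5 :
  packing_chromatic_number E <= 5.
Proof.
pose r i := if odd i then [:: 5; 1; 3; 1; 2; 1] else [:: 1; 2; 1; 3; 1; 4].
have r_ok i : valid_row 5 (r i) by rewrite /r; case: odd.
apply: (@packing_chromatic_number_rows _ r) => // i d _.
have [d3|] := leqP 3 d; first by apply: compatible_rows_far (r_ok i) _; lia.
by move: d => [|[|[|//]]] _; rewrite /r oddD; case: odd.
Qed.

Lemma hexagon_walk (i : 'I_(m %/ 3)) (x : 'I_6) (n : nat) :
  exists2 p : seq V, path E (i, x) p /\ size p = n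
                   & last (i, x) p = (i, iter n (@ordS 6) x).
Proof.
elim: n x => [|n IHn] x; first by exists [::].
have [p [ep sp] lp] := IHn (ordS x); exists ((i, ordS x) :: p).
  by split; rewrite /= ?sp // ep andbT /E /path_cycle_product
                    /path_aligned_product /cycle_graph /= !eqxx.
by rewrite /= lp -iterSr.
Qed.

Lemma packing_chromatic_number_hexagon_product_ge4 :
  0 < m %/ 3 -> 4 <= packing_chromatic_number E.
Proof.
move=> m0; apply: packing_chromatic_number_gt => c c_range c_dist.
pose i := Ordinal m0.
have [x] := @hexagon_no_packing_3_coloring (fun x => c (i, x))
              (fun x => c_range (i, x)).
case=> n [n3 cx nc]; have [p [ep sp] lp] := hexagon_walk i x n.
have xn : (i, x) != (i, iter n (@ordS 6) x) :> V.
  apply/eqP=> -[/(congr1 val)]; rewrite [in RHS]/= val_iter_ordS /=.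
  by move: (ltn_ord x) => x6; lia.
have := dist_geq_walk (c_dist _ _ xn cx) ep lp; rewrite sp; lia.
Qed.

End HexagonProduct.

Theorem theorem8 (t : nat) (ht : 1 <= t) :
  [/\ (t <= 2 -> packing_chromatic_number (@path_cycle_product (3 * t) 3 6 isT) <= 4),
      (3 <= t -> packing_chromatic_number (@path_cycle_product (3 * t) 3 6 isT) <= 5) &
      (t = 1 \/ t = 2 -> packing_chromatic_number (@path_cycle_product (3 * t) 3 6 isT) = 4)].
Proof.
have tE : 3 * t %/ 3 = t by rewrite mulKn.
have le4 : t <= 2 ->
    packing_chromatic_number (@path_cycle_product (3 * t) 3 6 isT) <= 4.
  by move=> t2; apply: packing_chromatic_number_hexagon_product_le4; rewrite tE.
split=> // [_|t12]; first exact: packing_chromatic_number_hexagon_product_le5.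
apply/eqP; rewrite eqn_leq le4 /=; last by case: t12 => ->.
by apply: packing_chromatic_number_hexagon_product_ge4; rewrite tE.
Qed.
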